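(* Let $G$ be a finitely generated group with finite symmetric generating set $S$, acting by isometries on a geodesic metric space $X$ with basepoint $o\in X$. Let $h\in G$ be a WPD isometry such that the orbit $\langle h\rangle o$ is strongly $\kappa$-contracting in $X$ for some sublinear function $\kappa$. Put $H=\langle h\rangle$. Then: (1) the action $G\curvearrowright X$ has the sublinear projection tracking property along $H$, i.e. there is a sublinear function $\kappa_{\mathrm{track}}$ such that for every $g\in G$, $$\mathrm{diam}_S\big(\mathrm{Pr}_H^S(g)\cup \mathrm{Pr}_H^X(g)\big)\le \kappa_{\mathrm{track}}(d_S(g,H));$$ (2) the pulled-back projection $\mathrm{Pr}_H^X$ is strongly sublinearly contracting in the word metric, i.e. there is a sublinear function $\kappa'$ such that for all $x,y\in G$ with $d_S(x,y)\le d_S(x,H)$, $$\mathrm{diam}_S\big(\mathrm{Pr}_H^X(x)\cup \mathrm{Pr}_H^X(y)\big)\le \kappa'(d_S(x,y)).$$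
   Context: A sublinear function is a non-decreasing positive function $\kappa:\mathbb R_+\to\mathbb R_+$ with $\kappa(r)/r\to 0$ as $r\to\infty$. $d_S$ is the word metric on $G$ and $\mathrm{diam}_S$ the diameter with respect to $d_S$. WPD: $h\in G$ is a WPD isometry if for every $r>0$ and $x\in X$ there is $N>0$ such that $\{g\in G: d_X(x,gx)\le r,\ d_X(h^Nx,gh^Nx)\le r\}$ is finite. Strongly $\kappa$-contracting orbit: writing $A=\langle h\rangle o\subseteq X$, this means that $A$ is a quasi-geodesic (that is, $n\mapsto h^n o$ is a quasi-isometric embedding of $\mathbb Z$ into $X$) and, for the shortest projection $\mathrm{Pr}_A(x)=\{a\in A: d_X(x,a)\le d_X(x,A)+1\}$, one has $\mathrm{diam}_X(\mathrm{Pr}_A(x)\cup \mathrm{Pr}_A(y))\le\kappa(d_X(x,y))$ for all $x,y\in X$ with $d_X(x,y)\le d_X(x,A)$. Projections on $G$: for a subgroup $H<G$ and $g\in G$, $\mathrm{Pr}_H^S(g)=\{h'\in H: d_S(g,h')=d_S(g,H)\}$ and $\mathrm{Pr}_H^X(g)=\{h'\in H: d_X(go,h'o)=d_X(go,Ho)\}$. *)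

(* Defs.v *)
From HB Require Import structures.
From mathcomp Require Import all_boot all_order all_algebra.
From mathcomp Require Import all_classical all_reals all_analysis.

Set Implicit Arguments.
Unset Strict Implicit.
Unset Printing Implicit Defensive.

Import Order.TTheory GRing.Theory Num.Theory.
Import numFieldNormedType.Exports.

Local Open Scope classical_set_scope.
Local Open Scope ring_scope.

(* A function on [0, +oo[ is represented by a total function on R whose values
   at negative reals are irrelevant. *)
Definition sublinear (R : realType) (kappa : R -> R) : Prop :=
  [/\ forall r, 0 <= r -> 0 < kappa r,
      forall r s, 0 <= r -> r <= s -> kappa r <= kappa s
    & kappa r / r @[r --> +oo] --> (0 : R)].

(* The notions of distance to a set, diameter, projection and contraction are
   relative to a distance function d, so that they apply both to a metric space
   and to a group with a word metric. *)

Definition dist_to (R : realType) (T : Type) (d : T -> T -> R)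
    (A : set T) (x : T) : R :=
  inf [set d x a | a in A].

Definition diam (R : realType) (T : Type) (d : T -> T -> R)
    (A : set T) : \bar R :=
  ereal_sup [set (d x y)%:E | x in A & y in A].

(* The additive 1 makes this nonempty for every nonempty A. *)
Definition shortest_proj (R : realType) (T : Type) (d : T -> T -> R)
    (A : set T) (x : T) : set T :=
  [set a | A a /\ d x a <= dist_to d A x + 1].

Definition strongly_contracting (R : realType) (T : Type) (kappa : R -> R)
    (d : T -> T -> R) (A : set T) (pr : T -> set T) : Prop :=
  forall x y, d x y <= dist_to d A x ->
    (diam d (pr x `|` pr y) <= (kappa (d x y))%:E)%E.

Definition strongly_sublinearly_contracting (R : realType) (T : Type)
    (d : T -> T -> R) (A : set T) (pr : T -> set T) : Prop :=
  exists2 kappa : R -> R, sublinear kappa & strongly_contracting kappa d A pr.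

Definition geodesic_space (R : realType) (X : metricType R) : Prop :=
  forall x y : X, exists gamma : R -> X,
    [/\ gamma 0 = x, gamma (mdist x y) = y
      & forall s t, 0 <= s <= mdist x y -> 0 <= t <= mdist x y ->
          mdist (gamma s) (gamma t) = `|s - t|].

Definition quasi_isometric_embedding_int (R : realType) (X : metricType R)
    (f : int -> X) : Prop :=
  exists L C : R, [/\ 1 <= L, 0 <= C
    & forall m n : int,
        L^-1 * `|m%:~R - n%:~R| - C <= mdist (f m) (f n)
          <= L * `|m%:~R - n%:~R| + C].

Definition zexpg (G : groupType) (g : G) (n : int) : G :=
  match n with
  | Posz k => (g ^+ k)%g
  | Negz k => (g ^- k.+1)%g
  end.

Definition cyclic_subgroup (G : groupType) (h : G) : set G := range (zexpg h).

Definition symmetric_set (G : groupType) (S : set G) : Prop :=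
  forall s, S s -> S (s^-1)%g.

Definition words (G : groupType) (S : set G) (g : G) : set (seq G) :=
  [set w | (forall s, s \in w -> S s) /\ (\prod_(s <- w) s)%g = g].

(* No inverses of letters are needed here because this is only used for
   symmetric sets. *)
Definition generating_set (G : groupType) (S : set G) : Prop :=
  forall g, words S g !=set0.

Definition word_length (R : realType) (G : groupType) (S : set G) (g : G) : R :=
  inf [set (size w)%:R | w in words S g].

Definition word_dist (R : realType) (G : groupType) (S : set G) (g k : G) : R :=
  word_length R S (g^-1 * k)%g.

Definition isometric_action (R : realType) (G : groupType) (X : metricType R)
    (act : G -> X -> X) : Prop :=
  [/\ forall x, act 1%g x = x,
      forall g k x, act (g * k)%g x = act g (act k x)
    & forall g x y, mdist (act g x) (act g y) = mdist x y].

Definition WPD (R : realType) (G : groupType) (X : metricType R)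
    (act : G -> X -> X) (h : G) : Prop :=
  forall (r : R) (x : X), 0 < r ->
    exists2 N : nat, (0 < N)%N
      & finite_set [set g | mdist x (act g x) <= r /\
          mdist (act (h ^+ N)%g x) (act g (act (h ^+ N)%g x)) <= r].

Definition strongly_contracting_orbit (R : realType) (G : groupType)
    (X : metricType R) (kappa : R -> R) (act : G -> X -> X) (h : G) (o : X)
    : Prop :=
  let A := [set act g o | g in cyclic_subgroup h] in
  quasi_isometric_embedding_int (fun n => act (zexpg h n) o) /\
  strongly_contracting kappa (@mdist R X) A (shortest_proj (@mdist R X) A).

Definition word_proj (R : realType) (G : groupType) (S : set G)
    (H : set G) (g : G) : set G :=
  [set k | H k /\ word_dist R S g k = dist_to (word_dist R S) H g].

Definition pullback_proj (R : realType) (G : groupType) (X : metricType R)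
    (act : G -> X -> X) (o : X) (H : set G) (g : G) : set G :=
  [set k | H k /\ mdist (act g o) (act k o) =
      dist_to (@mdist R X) [set act k' o | k' in H] (act g o)].

Definition sublinear_projection_tracking (R : realType) (G : groupType)
    (S : set G) (X : metricType R) (act : G -> X -> X) (o : X) (H : set G)
    : Prop :=
  exists2 kappa : R -> R, sublinear kappa
    & forall g : G,
        (diam (word_dist R S) (word_proj R S H g `|` pullback_proj act o H g)
          <= (kappa (dist_to (word_dist R S) H g))%:E)%E.

(* Main.v *)
Require Import Defs.
From HB Require Import structures.
From mathcomp Require Import all_boot all_order all_algebra.
From mathcomp Require Import all_classical all_reals all_analysis.
From mathcomp Require Import zify lra.

(** The theorem says that the projection to the axis [H = <h>] moves sublinearly
    along word-metric balls that do not cross [H]. Let [pr] choose almost nearest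
    points of the orbit of [H] in [X].

    In [X], contraction makes [pr] move at arbitrarily small speed along a path
    that stays far enough from the axis ([far_path_proj_le]). A path in the group
    may nevertheless stay near the axis in [X] while it is far from [H] in the
    word metric, because the action need not be proper. The WPD condition excludes
    this: if two points of the path at bounded word distance are both near the
    axis and their projections are far apart, then one of the two lies in [H V]
    for some finite set [V] ([wpd_finite_pairs]), hence is near [H] in the word
    metric. This rests on [wpd_finite_stabilizer], where the Morse property of the
    axis ([quasigeodesic_stays_near]) allows the second base point of the WPD
    condition to be pushed arbitrarily far along the axis.

    A word path of length at most [T] that avoids [H V] therefore moves [pr] at
    small speed up to a constant, and the constant does not depend on [T]
    ([short_word_path_proj_le]). Concatenating blocks with [T] large gives speed
    [e] for every [e] ([word_path_proj_le]). A geodesic word from [x] to [y] with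
    [dS x y <= dS x H] avoids [H V] except near its end, so [pr] moves by at most
    [e * dS x y + B e] from [x] to [y] ([proj_sublinear]), and
    [sublinear_envelope] turns these bounds into one sublinear function.
    Contraction is the case of two points [x] and [y]; tracking is the case in
    which [y] is an element of [H] nearest to [x], which projects to itself. *)

Set Implicit Arguments.
Unset Strict Implicit.
Unset Printing Implicit Defensive.

Import Order.TTheory GRing.Theory Num.Theory.

Local Open Scope classical_set_scope.
Local Open Scope ring_scope.

Ltac nat_lia :=
  repeat match goal with
  | H : is_true (_ <= _)%N |- _ => revert H
  | H : is_true ((_ <= _)%N && (_ <= _)%N) |- _ => revert H
  | H : _ = _ :> nat |- _ => revert H
  end; clear; lia.

(** * Sublinear functions *)

Lemma sublinear_eventually_le (R : realType) (kappa : R -> R) (e : R) :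
  sublinear kappa -> 0 < e ->
  exists2 M : R, 0 < M & forall r, M <= r -> kappa r <= e * r.
Proof.
move=> [kpos _ klim] e0.
have [M [Mreal HM]] : \forall r \near +oo, `|0 - kappa r / r| <= e.
  by move/cvgrPdist_le : klim; apply.
exists (Num.max 1 (M + 1)); first by rewrite lt_max ltr01.
move=> r; rewrite ge_max => /andP[r1 Mr].
have r0 : 0 < r by lra.
have /HM : M < r by lra.
by rewrite sub0r normrN => /(le_trans (ler_norm _)); rewrite ler_pdivrMr.
Qed.

(** Turns a family of linear bounds of arbitrarily small slope into one sublinear
    bound: the supremum of the values whose parameter is at most [s] is finite
    because of the bound of slope 1, and sublinear in [s] because of the others;
    adding 1 makes it positive. *)
Lemma sublinear_envelope (R : realType) (E : set (R * R)) :
  (forall e : R, 0 < e ->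
    exists B : R, forall p, E p -> 0 <= p.1 /\ p.2 <= e * p.1 + B) ->
  exists2 kappa : R -> R, sublinear kappa & forall p, E p -> p.2 <= kappa p.1.
Proof.
move=> EB.
pose V (s : R) := 0 |` [set p.2 | p in [set p | E p /\ p.1 <= s]].
have V0 s : V s 0 by left.
have Vne s : V s !=set0 by exists 0.
have Vub (e : R) : 0 < e -> exists2 B : R, 0 <= B &
    forall s, 0 <= s -> ubound (V s) (e * s + B).
  move=> e0; have [B HB] := EB e e0.
  exists (Num.max 0 B); first by rewrite le_max lexx.
  move=> s s0 _ [->|[p [Ep ps] <-]].
    by rewrite addr_ge0 ?le_max ?lexx// mulr_ge0// ltW.
  have [p0 /le_trans ->//] := HB p Ep.
  by rewrite lerD// ?le_max ?lexx ?orbT// ler_wpM2l// ltW.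
have Vhub s : 0 <= s -> has_ubound (V s).
  by move=> s0; have [B _ /(_ s s0)] := Vub 1 ltr01; exists (1 * s + B).
have sup0 s : 0 <= s -> 0 <= sup (V s).
  by move=> s0; apply: ub_le_sup => //; exact: Vhub.
exists (fun s => 1 + sup (V s)).
  split.
  - by move=> r r0; rewrite ltr_pwDl// sup0.
  - move=> r s r0 rs; rewrite lerD2l; apply: ge_sup => // v [->|[p [Ep pr] <-]].
      by rewrite sup0// (le_trans r0).
    apply: ub_le_sup; first by apply: Vhub; exact: le_trans rs.
    by right; exists p => //; split => //; exact: le_trans rs.
  - apply/cvgrPdist_le => e e0.
    have e20 : 0 < e / 2 by lra.
    have [B B0 HB] := Vub _ e20.
    (* From this point on the constant 1 + B costs at most another e / 2 * s. *)
    exists (2 * (1 + B) / e); split; first exact: num_real.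
    move=> s; rewrite ltr_pdivrMr// => es.
    have s0 : 0 < s.
      by rewrite -(pmulr_lgt0 _ e0); apply: lt_trans es; lra.
    rewrite sub0r normrN ger0_norm; last first.
      by rewrite divr_ge0 ?(ltW s0)// addr_ge0// sup0// ltW.
    rewrite ler_pdivrMr//.
    have : sup (V s) <= e / 2 * s + B by apply: ge_sup => //; exact/HB/ltW.
    by lra.
move=> p Ep.
have [_ /(_ p Ep)[p0 _]] := EB 1 ltr01.
apply: (@le_trans _ _ (sup (V p.1))); last by rewrite lerDr.
by apply: ub_le_sup; [exact: Vhub|right; exists p].
Qed.

(** * Discrete paths *)

Lemma first_after (P : nat -> Prop) (m n : nat) : (m <= n)%N -> P n ->
  exists b, [/\ (m <= b <= n)%N, P b & forall i, (m <= i < b)%N -> ~ P i].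
Proof.
move=> mn Pn.
have ex : exists b, (m <= b <= n)%N && `[< P b >].
  by exists n; rewrite mn leqnn; apply/asboolP.
case: (ex_minnP ex) => b /andP[/andP[mb bn] /asboolP Pb] bmin.
exists b; split=> //; first by rewrite mb bn.
move=> i /andP[mi ib] Pi.
suff : (b <= i)%N by nat_lia.
by apply: bmin; rewrite mi (leq_trans (ltnW ib) bn); exact/asboolP.
Qed.

Lemma last_before (P : nat -> Prop) (m n : nat) : (m <= n)%N -> P m ->
  exists a, [/\ (m <= a <= n)%N, P a & forall i, (a < i <= n)%N -> ~ P i].
Proof.
move=> mn Pm.
have [|b [/andP[_ bn] Pb bmin]] := @first_after (fun i => P (n - i)%N) 0 (n - m) isT.
  by rewrite subKn.
exists (n - b)%N; split=> //; first by apply/andP; nat_lia.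
move=> i ib Pi; apply: (bmin (n - i)%N); first by nat_lia.
by rewrite subKn//; nat_lia.
Qed.

Section Paths.
Context (R : realType) (X : metricType R).
Local Notation d := (@mdist R X).

Lemma path_dist_le (q : nat -> X) (J : R) (i k : nat) :
  (forall j, (i <= j < i + k)%N -> d (q j) (q j.+1) <= J) ->
  d (q i) (q (i + k)%N) <= J * k%:R.
Proof.
elim: k => [|k IH] qJ; first by rewrite addn0 mdistxx mulr0.
have := metric_triangle (q i) (q (i + k)%N) (q (i + k.+1)%N).
have := qJ (i + k)%N ltac:(nat_lia); rewrite -addnS.
have := IH (fun j jk => qJ j ltac:(nat_lia)).
by rewrite -(addn1 k) natrD mulrDr mulr1; lra.
Qed.

(** A path whose blocks of length [T] each progress at speed [e] progresses at
    speed [e]; the last, incomplete block costs the additive constant. *)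
Lemma chain_dist_le (y : nat -> X) (T m : nat) (e C : R) :
  (0 < T)%N -> 0 <= e ->
  (forall i, (i + T <= m)%N -> d (y i) (y (i + T)%N) <= e * T%:R) ->
  (forall i n, (n <= T)%N -> (i + n <= m)%N -> d (y i) (y (i + n)%N) <= C) ->
  d (y 0%N) (y m) <= e * m%:R + C.
Proof.
move=> T0 e0 yT yC.
suff H n : forall i, (i + n <= m)%N -> d (y i) (y (i + n)%N) <= e * n%:R + C.
  exact: (H m 0%N).
elim/ltn_ind: n => n IH i inm.
have [nT|Tn] := leqP n T.
  by rewrite (le_trans (yC i n nT inm))// lerDr mulr_ge0.
have := metric_triangle (y i) (y (i + T)%N) (y (i + n)%N).
have := yT i ltac:(nat_lia).
have := IH (n - T)%N ltac:(nat_lia) (i + T)%N ltac:(nat_lia).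
have -> : (i + T + (n - T) = i + n)%N by nat_lia.
have -> : n%:R = T%:R + (n - T)%:R :> R by rewrite -natrD subnKC// ltnW.
by lra.
Qed.

End Paths.

(** * Nearest-point projections *)

Section Projection.
Context (R : realType) (X : metricType R) (A : set X).
Local Notation d := (@mdist R X).
Local Notation rho := (dist_to d A).

Lemma has_lbound_dists (x : X) : has_lbound [set d x a | a in A].
Proof. by exists 0 => _ [a _ <-]; exact: mdist_ge0. Qed.

Lemma dist_to_le (x a : X) : A a -> rho x <= d x a.
Proof. by move=> Aa; apply: ge_inf; [exact: has_lbound_dists|exists a]. Qed.

Lemma dist_to_ge0 (x : X) : A !=set0 -> 0 <= rho x.
Proof.
move=> [a0 Aa0]; apply: lb_le_inf; first by exists (d x a0), a0.
by move=> _ [a _ <-]; exact: mdist_ge0.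
Qed.

Lemma shortest_proj_nonempty (x : X) : A !=set0 -> shortest_proj d A x !=set0.
Proof.
move=> [a0 Aa0].
have [||_ [a Aa <-] /ltW xa] := @inf_adherent R [set d x a | a in A] 1.
- exact: ltr01.
- by split; [exists (d x a0), a0|exact: has_lbound_dists].
- by exists a.
Qed.

Lemma dist_to_lipschitz (x y : X) : A !=set0 -> rho x <= d x y + rho y.
Proof.
move=> [a0 Aa0]; rewrite -lerBlDl; apply: lb_le_inf; first by exists (d y a0), a0.
move=> _ [a Aa <-]; have := metric_triangle x y a; have := dist_to_le x Aa; lra.
Qed.

End Projection.

(** * Projection to a contracting set *)

Section Contracting.
Context (R : realType) (X : metricType R) (A : set X) (kappa : R -> R).
Local Notation d := (@mdist R X).
Local Notation rho := (dist_to d A).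
Context (kappaS : sublinear kappa) (pr : X -> X).
Context (pr_near : forall x, shortest_proj d A x (pr x)).
Context (pr_contr : forall x y, d x y <= rho x ->
  d (pr x) (pr y) <= kappa (d x y)).

Let A_nonempty (x : X) : A !=set0.
Proof. by exists (pr x); case: (pr_near x). Qed.

Lemma dist_proj_le x : d x (pr x) <= rho x + 1.
Proof. by case: (pr_near x). Qed.

(** Contraction gives the bound as long as the first point is far from [A]
    compared with the distance between the points; otherwise both points are
    close to [A], hence to their projections. *)
Lemma proj_coarsely_lipschitz (t : R) : 0 <= t ->
  exists2 B : R, 0 <= B & forall x y, d x y <= t -> d (pr x) (pr y) <= B.
Proof.
move=> t0; have [kpos kmono _] := kappaS.
have kt := kpos t t0.
exists (kappa t + 4 * t + 2); first by lra.
move=> x y xyt.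
have [xy|xy] := leP (d x y) (rho x).
  have := pr_contr xy; have := kmono _ _ (mdist_ge0 x y) xyt; lra.
have := metric_triangle (pr x) x (pr y); have := metric_triangle x y (pr y).
have := dist_proj_le x; have := dist_proj_le y.
have := dist_to_lipschitz y x (A_nonempty x).
by rewrite (metric_sym (pr x) x) (metric_sym y x); lra.
Qed.

(** Choose [T] so large that [kappa (J * T)] is at most [eta * T]. A block of [T]
    steps has length at most [J * T], so contraction applies to it as soon as it
    starts [J * T] away from [A], and its projection moves by at most [eta * T].
    The two endpoints of the path may lie close to [A]: [B] absorbs the first
    step as well as the incomplete last block. *)
Lemma far_path_proj_le (J eta : R) : 0 < J -> 0 < eta ->
  exists D B : R, [/\ 0 <= D, 0 <= B & forall (q : nat -> X) (n : nat),
    (forall i, (i < n)%N -> d (q i) (q i.+1) <= J) ->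
    (forall i, (0 < i < n)%N -> D <= rho (q i)) ->
    d (pr (q 0%N)) (pr (q n)) <= eta * n%:R + B].
Proof.
move=> J0 eta0; have [kpos kmono _] := kappaS.
have [M M0 kM] := sublinear_eventually_le kappaS (divr_gt0 eta0 J0).
pose T := (Num.bound (M / J)).+1.
have MT : M <= J * T%:R.
  rewrite mulrC -ler_pdivrMr// ltW// (lt_le_trans (archi_boundP _))//.
    by rewrite divr_ge0// ltW.
  by rewrite ler_nat.
have D0 : 0 <= J * T%:R by rewrite mulr_ge0// ltW.
have kT : kappa (J * T%:R) <= eta * T%:R.
  rewrite (le_trans (kM _ MT))// le_eqVlt; apply/orP; left; apply/eqP.
  by rewrite mulrA divfK// gt_eqF.
have [B B0 HB] := proj_coarsely_lipschitz D0.
have stepB q i n : (n <= T)%N ->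
    (forall j, (i <= j < i + n)%N -> d (q j) (q j.+1) <= J) ->
    d (q i) (q (i + n)%N) <= J * T%:R.
  move=> nT /path_dist_le/le_trans; apply.
  by rewrite ler_wpM2l ?(ltW J0)// ler_nat.
exists (J * T%:R), (B + B); split=> //; first by rewrite addr_ge0.
move=> q [|n] qJ qfar.
  by rewrite mdistxx mulr0 add0r addr_ge0.
(* The far blocks can only start at index 1. *)
have e1 : d (pr (q 0%N)) (pr (q 1%N)) <= B.
  by apply: HB; apply: (stepB q 0%N 1%N) => // j j1; apply: qJ; nat_lia.
have : d (pr (q 1%N)) (pr (q n.+1)) <= eta * n%:R + B.
  apply: (@chain_dist_le _ _ (fun i => pr (q i.+1)) T n) => //; first exact: ltW.
  - move=> i iTn.
    have dT : d (q i.+1) (q (i + T).+1) <= J * T%:R.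
      by rewrite -addSn; apply: stepB => // j jT; apply: qJ; nat_lia.
    have far : J * T%:R <= rho (q i.+1) by apply: qfar; nat_lia.
    apply: (le_trans (pr_contr (le_trans dT far))).
    by apply: le_trans kT; apply: kmono => //; exact: mdist_ge0.
  - move=> i k kT' ikn; apply: HB.
    by rewrite -addSn; apply: stepB => // j jT; apply: qJ; nat_lia.
have := metric_triangle (pr (q 0%N)) (pr (q 1%N)) (pr (q n.+1)).
rewrite -(addn1 n) natrD mulrDr mulr1; lra.
Qed.

(** The Morse property. On an excursion far from [A] the projection moves at half
    the speed that the quasi-geodesic must keep, while the endpoints of the
    excursion are close to their projections; this bounds the duration of the
    excursion, hence its distance to [A]. The bound is uniform in [k]. *)
Lemma quasigeodesic_stays_near (J L C r : R) : 0 < J -> 0 < L ->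
  exists M : R, forall (q : nat -> X) (k : nat),
    (forall i, (i < k)%N -> d (q i) (q i.+1) <= J) ->
    (forall i n, (i + n <= k)%N -> L^-1 * n%:R - C <= d (q i) (q (i + n)%N)) ->
    rho (q 0%N) <= r -> rho (q k) <= r ->
    forall j, (j <= k)%N -> rho (q j) <= M.
Proof.
move=> J0 L0.
have eta0 : 0 < L^-1 / 2 by rewrite divr_gt0// invr_gt0.
have [D [B [D0 B0 far]]] := far_path_proj_le J0 eta0.
pose D' := Num.max D r.
have DD' : D <= D' by rewrite le_max lexx.
have rD' : r <= D' by rewrite le_max lexx orbT.
exists (D' + J * (2 * L * (2 * D' + 2 + B + C))) => q k qJ qL q0 qk j jk.
(* The indices a and b delimit the excursion that contains j. *)
have [a [/andP[_ aj] qa alast]] := @last_before (fun i => rho (q i) <= D') 0 j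
  isT (le_trans q0 rD').
have [b [/andP[jb bk] qb bfirst]] := @first_after (fun i => rho (q i) <= D') j k
  jk (le_trans qk rD').
have bE : b = (a + (b - a))%N by nat_lia.
have : d (pr (q a)) (pr (q b)) <= L^-1 / 2 * (b - a)%:R + B.
  have := far (fun i => q (a + i)%N) (b - a)%N; rewrite addn0 -bE; apply.
    by move=> i iab; rewrite addnS; apply: qJ; nat_lia.
  move=> i /andP[i0 iab]; rewrite (le_trans DD')// leNgt; apply/negP => /ltW near.
  have [aij|jai] := leqP (a + i) j.
    by apply: (alast (a + i)%N) => //; nat_lia.
  by apply: (bfirst (a + i)%N) => //; nat_lia.
have := qL a (b - a)%N ltac:(nat_lia); rewrite -bE.
have := dist_proj_le (q a); have := dist_proj_le (q b).
have := metric_triangle (q a) (pr (q a)) (q b).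
have := metric_triangle (pr (q a)) (pr (q b)) (q b).
rewrite (metric_sym (pr (q b))) => *.
have : (b - a)%:R <= 2 * L * (2 * D' + 2 + B + C).
  by rewrite -ler_pdivrMl ?mulr_gt0// invfM; lra.
rewrite -(ler_pM2l J0) => Jab.
have : d (q a) (q j) <= J * (j - a)%:R.
  have {1}-> : j = (a + (j - a))%N by nat_lia.
  by apply: path_dist_le => i ia; apply: qJ; nat_lia.
have : J * (j - a)%:R <= J * (b - a)%:R.
  by rewrite ler_wpM2l ?(ltW J0)// ler_nat; nat_lia.
have := dist_to_lipschitz (q j) (q a) (A_nonempty (q j)).
rewrite (metric_sym (q j)); lra.
Qed.

End Contracting.

(** * Finite sets *)

Lemma finite_set_bounded (R : realType) (T : Type) (F : set T) (f : T -> R) :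
  finite_set F -> exists2 M : R, 0 < M & forall x, F x -> f x <= M.
Proof.
move=> /finite_image -/(_ _ f)/finite_seqP[s fE].
suff [M M0 sM] : exists2 M : R, 0 < M & forall v, v \in s -> v <= M.
  exists M => // x Fx; apply: sM.
  have : [set f x | x in F] (f x) by exists x.
  by rewrite fE.
elim: s {fE} => [|v s [M M0 sM]]; first by exists 1.
exists (Num.max v M); first by rewrite lt_max M0 orbT.
move=> w; rewrite inE => /orP[/eqP ->|/sM wM]; first by rewrite le_max lexx.
by rewrite le_max wM orbT.
Qed.

Lemma finite_int_le (R : realType) (c : R) :
  finite_set [set m : int | `|m%:~R| <= c].
Proof.
pose N := (Num.bound c).+1.
apply: (@sub_finite_set _ _ ([set Posz n | n in `I_N] `|` [set - Posz n | n in `I_N])).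
  move=> m /= mc.
  have : (`|m| < N)%N.
    have : (`|m|%N)%:R <= c by rewrite natr_absz -intr_norm in mc *.
    have [c0|c0] := leP 0 c; last by move=> /(le_trans (ler0n _ _)); lra.
    by move=> /le_lt_trans/(_ (archi_boundP c0)); rewrite ltr_nat => /leqW.
  have [m0|m0] := leP 0 m => mN.
    by left; exists `|m|%N => //; lia.
  by right; exists `|m|%N => //; lia.
by rewrite finite_setU; split; apply: finite_image; exact: finite_II.
Qed.

Section Words.
Context (G : groupType).
Implicit Types (S : set G) (g k : G).
Local Open Scope group_scope.

(** * Powers of an element *)

Lemma zexpgS g (n : int) : zexpg g (n + 1)%R = zexpg g n * g.
Proof.
case: n => [n|[|n]] /=; first by rewrite addn1 expgSr.
  by rewrite expg1 mulVg.
by rewrite (expgS _ n.+1) invgM mulgVK subn1.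
Qed.

Lemma zexpgD g (m n : int) : zexpg g (m + n)%R = zexpg g m * zexpg g n.
Proof.
elim/int_ind: n => [|n IH|n IH]; first by rewrite addr0 mulg1.
  by rewrite (_ : n.+1%:Z = n%:Z + 1)%R ?addrA ?zexpgS ?IH ?mulgA//; lia.
apply: (mulIg g); rewrite -mulgA -!zexpgS.
have -> : (- n.+1%:Z + 1 = - n%:Z)%R by lia.
by rewrite -IH; congr zexpg; lia.
Qed.

Lemma zexpgN g (n : int) : zexpg g (- n)%R = (zexpg g n)^-1.
Proof. by apply: (mulIg (zexpg g n)); rewrite -zexpgD addNr mulVg. Qed.

(** * Word metrics *)

(** Unlike the sphere of radius [n] of the word metric, it also contains the
    elements that have words shorter than [n] besides one of length [n]. *)
Fixpoint word_sphere S (n : nat) : set G :=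
  if n is m.+1 then [set (u * s)%g | u in word_sphere S m & s in S] else [set 1%g].

Lemma finite_word_sphere S n : finite_set S -> finite_set (word_sphere S n).
Proof.
move=> finS; elim: n => [|n IH] /=; first exact: finite_set1.
exact: finite_image2.
Qed.

Lemma word_sphere_path S (p : nat -> G) (i k : nat) :
  (forall j, (i <= j < i + k)%N -> S ((p j)^-1 * p j.+1)) ->
  word_sphere S k ((p i)^-1 * p (i + k)%N).
Proof.
elim: k => [|k IH] pS /=; first by rewrite addn0 mulVg.
exists ((p i)^-1 * p (i + k)%N).
  by apply: IH => j jk; apply: pS; nat_lia.
exists ((p (i + k)%N)^-1 * p (i + k.+1)%N); first by rewrite addnS; apply: pS; nat_lia.
by rewrite -mulgA mulVKg.
Qed.

Lemma words_path S x y w : words S (x^-1 * y) w -> exists p : nat -> G,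
  [/\ p 0%N = x, p (size w) = y &
      forall i, (i < size w)%N -> S ((p i)^-1 * p i.+1)].
Proof.
move=> [wS wxy]; exists (fun i => x * \prod_(s <- take i w) s); split.
- by rewrite take0 big_nil mulg1.
- by rewrite take_size wxy mulVKg.
- move=> i iw; rewrite (take_nth 1%g iw) -cats1 big_cat big_seq1/=.
  by rewrite (mulgA x) mulKg; apply: wS; exact: mem_nth.
Qed.

Lemma words_cat S g k v w : words S g v -> words S k w ->
  words S (g * k) (v ++ w).
Proof.
move=> [vS <-] [wS <-]; split; last by rewrite big_cat.
by move=> s; rewrite mem_cat => /orP[/vS|/wS].
Qed.

Lemma words_inv S g w : symmetric_set S -> words S g w ->
  words S g^-1 (map monoid.inv (rev w)).
Proof.
move=> symS [wS <-]; split.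
  by move=> _ /mapP[s sw ->]; apply/symS/wS; rewrite mem_rev in sw.
by rewrite big_map prodgV revK.
Qed.

Context (R : realType) (S : set G) (genS : generating_set S).
Local Notation wl := (word_length R S).
Local Notation dS := (word_dist R S).

Lemma word_length_le g w : words S g w -> (wl g <= (size w)%:R)%R.
Proof. by move=> gw; apply: ge_inf; [exists 0%R => _ [v _ <-]|exists w]. Qed.

Lemma word_length_attained g : exists2 w, words S g w & wl g = (size w)%:R%R.
Proof.
have [w0 gw0] := genS g.
have ex : exists n, `[< exists2 w, words S g w & size w = n >].
  by exists (size w0); apply/asboolP; exists w0.
case: (ex_minnP ex) => n /asboolP[w gw wn] nmin.
exists w => //; apply/eqP; rewrite eq_le word_length_le//=.
apply: lb_le_inf; first by exists (size w)%:R%R, w.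
move=> _ [v gv <-]; rewrite ler_nat wn; apply: nmin.
by apply/asboolP; exists v.
Qed.

Lemma word_length_ge0 g : (0 <= wl g)%R.
Proof. by have [w _ ->] := word_length_attained g. Qed.

Lemma word_lengthM g k : (wl (g * k) <= wl g + wl k)%R.
Proof.
have [v gv ->] := word_length_attained g; have [w kw ->] := word_length_attained k.
by rewrite -natrD -size_cat; apply: word_length_le; exact: words_cat.
Qed.

Lemma word_lengthV g : symmetric_set S -> wl g^-1 = wl g.
Proof.
move=> symS; suff le k : (wl k^-1 <= wl k)%R.
  by apply/eqP; rewrite eq_le le -{1}(invgK g) le.
have [w kw ->] := word_length_attained k.
by rewrite -(size_rev w) -(size_map monoid.inv); apply/word_length_le/words_inv.
Qed.

Lemma word_length1 : wl 1 = 0%R.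
Proof.
apply/eqP; rewrite eq_le word_length_ge0 andbT.
by apply: (@word_length_le 1 [::]); split => //; rewrite big_nil.
Qed.

Lemma word_distxx g : dS g g = 0%R.
Proof. by rewrite /word_dist mulVg word_length1. Qed.

Lemma word_dist_sym g k : symmetric_set S -> dS g k = dS k g.
Proof. by move=> symS; rewrite /word_dist -word_lengthV// invgM invgK. Qed.

Lemma word_dist_triangle g k l : (dS g l <= dS g k + dS k l)%R.
Proof.
by have := word_lengthM (g^-1 * k) (k^-1 * l); rewrite -mulgA mulVKg.
Qed.

Lemma word_path_dist_le (p : nat -> G) n :
  (forall i, (i < n)%N -> S ((p i)^-1 * p i.+1)) ->
  (dS (p 0%N) (p n) <= n%:R)%R.
Proof.
elim: n => [|n IH] pS; first by rewrite word_distxx.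
apply: (le_trans (word_dist_triangle _ (p n) _)).
rewrite -(addn1 n) natrD; apply: lerD; first by apply: IH => i /ltnW; exact: pS.
apply: (@word_length_le _ [:: (p n)^-1 * p (n + 1)%N]); split.
  by move=> s; rewrite inE => /eqP ->; rewrite addn1; exact: pS.
by rewrite big_seq1.
Qed.

Lemma word_dist_to_le (H : set G) g k : H k -> (dist_to dS H g <= dS g k)%R.
Proof.
move=> Hk; apply: ge_inf; last by exists k.
by exists 0%R => _ [l _ <-]; exact: word_length_ge0.
Qed.

Lemma word_dist_to_ge0 (H : set G) g : H !=set0 -> (0 <= dist_to dS H g)%R.
Proof.
move=> [k0 Hk0]; apply: lb_le_inf; first by exists (dS g k0), k0.
by move=> _ [k _ <-]; exact: word_length_ge0.
Qed.

Lemma word_length_zexpg_le h : exists2 c : R, (0 <= c)%R &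
  forall n, (wl (zexpg h n) <= c * `|n%:~R|)%R.
Proof.
have nat_le g (n : nat) : (wl (g ^+ n) <= wl g * n%:R)%R.
  elim: n => [|n IH]; first by rewrite expg0 word_length1 mulr0.
  rewrite expgSr (le_trans (word_lengthM _ _))//.
  by rewrite -(addn1 n) natrD mulrDr mulr1 lerD2r.
exists (wl h + wl h^-1)%R; first by rewrite addr_ge0 ?word_length_ge0.
have c1 := word_length_ge0 h; have c2 := word_length_ge0 h^-1.
case=> n; rewrite ?NegzE ?mulrNz ?normrN normr_nat.
  by rewrite (le_trans (nat_le h n))// ler_wpM2r// lerDl.
rewrite -NegzE /= -expVgn (le_trans (nat_le _ _))//.
by rewrite ler_wpM2r// lerDr.
Qed.

End Words.

(** * Isometric actions with a contracting axis *)

Lemma diam_le (R : realType) (T : Type) (d : T -> T -> R) (A B : set T) :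
  A `<=` B -> (diam d A <= diam d B)%E.
Proof.
move=> AB; apply: ereal_sup_le => _ [x Ax [y Ay <-]].
by exists x; [exact: AB|exists y => //; exact: AB].
Qed.

Section Axis.
Context (R : realType) (G : groupType) (X : metricType R) (act : G -> X -> X).
Context (actX : isometric_action act) (o : X) (h : G) (kappa : R -> R).
Context (kappaS : sublinear kappa).
Context (contr_h : strongly_contracting_orbit kappa act h o).
Local Notation d := (@mdist R X).
Local Notation pt n := (act (zexpg h n) o).
Local Notation A := [set act g o | g in cyclic_subgroup h].
Local Notation rho := (dist_to d A).

Lemma act1 x : act 1%g x = x. Proof. by case: actX. Qed.

Lemma actM g k x : act (g * k)%g x = act g (act k x).
Proof. by case: actX. Qed.

Lemma act_dist g x y : d (act g x) (act g y) = d x y.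
Proof. by case: actX. Qed.

Lemma act_dist_swap g x y : d (act g x) y = d x (act (g^-1)%g y).
Proof. by rewrite -(act_dist g^-1%g) -actM mulVg act1. Qed.

Lemma axis_pt n : A (pt n).
Proof. by exists (zexpg h n) => //; exists n. Qed.

Lemma pt0 : pt 0 = o.
Proof. exact: act1. Qed.

Lemma act_pt (m n : int) : act (zexpg h m) (pt n) = pt (m + n).
Proof. by rewrite -actM zexpgD. Qed.

Lemma pt_dist_step (n : nat) : d (pt n) (pt n.+1) = d o (act h o).
Proof. by rewrite /= expgSr actM act_dist. Qed.

Lemma axis_quasigeodesic : exists L C : R, [/\ 0 < L, 0 <= C &
  forall m n : int, L^-1 * `|m%:~R - n%:~R| - C <= d (pt m) (pt n)
    <= L * `|m%:~R - n%:~R| + C].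
Proof.
have [[L [C [L1 C0 LC]]] _] := contr_h.
by exists L, C; split=> //; exact: lt_le_trans ltr01 L1.
Qed.

Lemma axis_contracting x y a b : d x y <= rho x ->
  shortest_proj d A x a -> shortest_proj d A y b -> d a b <= kappa (d x y).
Proof.
move=> /(proj2 contr_h) Hk xa yb; rewrite -lee_fin (le_trans _ Hk)//.
by apply: ereal_sup_ubound; exists a; [left|exists b; [right|]].
Qed.

(* An arbitrary choice of an almost nearest point of the axis. *)
Context (pr : X -> X) (pr_near : forall x, shortest_proj d A x (pr x)).

Let pr_contr x y : d x y <= rho x -> d (pr x) (pr y) <= kappa (d x y).
Proof. by move=> xy; apply: axis_contracting. Qed.

Let pr_far := far_path_proj_le kappaS pr_near pr_contr.

(** * The WPD condition along the axis *)

Context (wpd_h : WPD act h).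

(** The WPD condition bounds the displacement at the points [o] and [h ^+ N o],
    where [N] depends on the bound; here the second point may be any [pt k] with
    [k] at least [N]. An isometry [f] that moves [o] and [pt k] little maps the
    axis to a quasi-geodesic that starts and ends near the axis, so by the Morse
    property [act f (pt N)] is close to some [pt m], and [m] takes finitely many
    values. Two such isometries with the same [m] differ by an isometry that
    moves both [o] and [pt N] by a bounded amount, and [N] is the number that WPD
    gives for this bound. *)
Lemma wpd_finite_stabilizer (r : R) : 0 <= r -> exists N : nat,
  forall k : nat, (N <= k)%N ->
  finite_set [set f | d (act f o) o <= r /\ d (act f (pt k)) (pt k) <= r].
Proof.
move=> r0; have [L [C [L0 C0 LC]]] := axis_quasigeodesic.
pose J := d o (act h o) + 1.
have J0 : 0 < J by rewrite ltr_wpDl// mdist_ge0.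
have [M HM] := quasigeodesic_stays_near kappaS pr_near pr_contr C r J0 L0.
pose r' := Num.max 1 (Num.max (2 * r) (2 * (M + 1))).
have r'0 : 0 < r' by rewrite lt_max ltr01.
have [r1 r2] : 2 * r <= r' /\ 2 * (M + 1) <= r'.
  by rewrite !le_max !lexx !orbT.
have [N N0 finN] := wpd_h o r'0; exists N => k Nk.
pose c := L * (M + 1 + d (pt N) o + r + C).
pose F (m : int) := [set f | d (act f o) o <= r /\ d (act f (pt N)) (pt m) <= M + 1].
apply: (@sub_finite_set _ _ (\bigcup_(m in [set m : int | `|m%:~R| <= c]) F m)).
  move=> f /= [fo fk].
  have fN : rho (act f (pt N)) <= M.
    apply: (HM (fun i => act f (pt i)) k) => //.
    - by move=> i _; rewrite act_dist pt_dist_step lerDl.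
    - move=> i n _; rewrite act_dist.
      have /andP[+ _] := LC i (i + n)%N.
      by rewrite distrC PoszD intrD addrAC subrr add0r normr_nat.
    - by rewrite (le_trans (dist_to_le _ (axis_pt 0)))// pt0.
    - by rewrite (le_trans (dist_to_le _ (axis_pt k))).
  have [[_ [m _ <-] am] near] := pr_near (act f (pt N)).
  rewrite -am in near.
  have {}near : d (act f (pt N)) (pt m) <= M + 1 by lra.
  exists m => //=.
  have /andP[+ _] := LC m 0; rewrite subr0 pt0 => lb.
  rewrite /c -ler_pdivrMl//.
  have := metric_triangle (pt m) (act f (pt N)) o.
  have := metric_triangle (act f (pt N)) (act f o) o.
  rewrite act_dist (metric_sym (pt m) (act f _)); lra.
apply: bigcup_finite; first exact: finite_int_le.
move=> m _; have [[f0 [f0o f0N]]|none] := pselect (F m !=set0); last first.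
  by rewrite (_ : F m = set0)//; apply/eqP/negPn/negP => /set0P.
apply: (@sub_finite_set _ _ [set (f0 * g)%g | g in [set g | d o (act g o) <= r' /\
    d (act (h ^+ N)%g o) (act g (act (h ^+ N)%g o)) <= r']]); last exact: finite_image.
move=> f [fo fN]; exists (f0^-1 * f)%g; last by rewrite mulVKg.
split; rewrite actM -act_dist_swap.
  by have := metric_triangle (act f0 o) o (act f o); rewrite (metric_sym o); lra.
have := metric_triangle (act f0 (pt N)) (pt m) (act f (pt N)).
by rewrite (metric_sym (pt m)); rewrite /=; lra.
Qed.

(** Two orbit points [g o] and [g u o], joined by one of finitely many [u] and
    close to points of the axis that are far apart, force [g] into [H V] for a
    finite set [V]: after a translation of [pt a] to [o], any two such [g] with
    the same [u] and the same [b - a] differ by an element to which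
    [wpd_finite_stabilizer] applies, and [u] leaves finitely many values for
    [b - a]. The threshold [N] does not depend on [U]. *)
Lemma wpd_finite_forward (D : R) : 0 <= D -> exists N : nat,
  forall U : set G, finite_set U -> exists2 V : set G, finite_set V &
  forall g u (a b : int), U u -> d (act g o) (pt a) <= D ->
    d (act (g * u)%g o) (pt b) <= D -> N%:Z <= b - a ->
    V (zexpg h (- a) * g)%g.
Proof.
move=> D0; have [L [C [L0 C0 LC]]] := axis_quasigeodesic.
have [|N HN] := wpd_finite_stabilizer (r := 2 * D); first by lra.
exists N => U finU.
pose W u (k : nat) :=
  [set g | d (act g o) o <= D /\ d (act (g * u)%g o) (pt k) <= D].
pose c u := L * (D + d (act u o) o + D + C).
exists (\bigcup_(u in U) \bigcup_(m in [set m : int | `|m%:~R| <= c u] `&`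
    [set m | N%:Z <= m]) W u `|m|%N).
  apply: bigcup_finite => // u _; apply: bigcup_finite.
    by apply: finite_setIl; exact: finite_int_le.
  move=> m [_ /= Nm].
  have [[g0 [g0o g0k]]|none] := pselect (W u `|m|%N !=set0); last first.
    by rewrite (_ : W _ _ = set0)//; apply/eqP/negPn/negP => /set0P.
  have Nm' : (N <= `|m|)%N by lia.
  apply: (sub_finite_set _ (finite_image (fun f => f * g0)%g (HN _ Nm'))).
  move=> g [go gk]; exists (g * g0^-1)%g; last by rewrite mulgVK.
  split.
    have := metric_triangle (act (g * g0^-1)%g o) (act g o) o.
    rewrite actM act_dist (metric_sym _ o) act_dist_swap invgK.
    by rewrite (metric_sym o (act g0 o)); lra.
  have := metric_triangle (act (g * g0^-1)%g (pt `|m|%N)) (act (g * u)%g o) (pt `|m|%N).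
  rewrite [X in X + _](_ : _ = d (act (g0 * u)%g o) (pt `|m|%N)); last first.
    by rewrite !actM act_dist act_dist_swap invgK metric_sym.
  by lra.
move=> g u a b Uu ga gb Nab; exists u => //.
(* Translation by a power of h reduces to a = 0. *)
have ga' : d (act (zexpg h (- a) * g)%g o) o <= D.
  by rewrite actM act_dist_swap zexpgN invgK.
have gb' : d (act (zexpg h (- a) * g * u)%g o) (pt (b - a)) <= D.
  by rewrite -mulgA actM act_dist_swap zexpgN invgK act_pt addrC subrK.
exists (b - a); last first.
  split=> //; rewrite (_ : `|b - a|%N = b - a :> int)//.
  by rewrite gez0_abs// (le_trans _ Nab).
split=> //=; have /andP[+ _] := LC (b - a) 0; rewrite subr0 pt0 => lb.
rewrite /c -ler_pdivrMl//.
have := metric_triangle (pt (b - a)) (act (zexpg h (- a) * g * u)%g o) o.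
have := metric_triangle (act (zexpg h (- a) * g * u)%g o) (act (zexpg h (- a) * g)%g o) o.
rewrite (actM _ u) act_dist (metric_sym (pt (b - a)) (act _ _)) -actM; lra.
Qed.

Lemma wpd_finite_pairs (D : R) : 0 <= D -> exists N : nat,
  forall U : set G, finite_set U -> exists2 V : set G, finite_set V &
  forall g u (a b : int), U u -> d (act g o) (pt a) <= D ->
    d (act (g * u)%g o) (pt b) <= D -> N%:Z <= `|b - a| ->
    V (zexpg h (- a) * g)%g \/ V (zexpg h (- b) * (g * u))%g.
Proof.
move=> D0; have [N HN] := wpd_finite_forward D0.
exists N => U finU.
have [|V finV HV] := HN (U `|` [set (u^-1)%g | u in U]).
  by rewrite finite_setU; split=> //; exact: finite_image.
exists V => // g u a b Uu ga gb Nab.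
have [ba|ab] := leP 0 (b - a).
  by left; apply: (HV g u a b) => //; [left|rewrite ger0_norm in Nab].
right; apply: (HV (g * u)%g (u^-1)%g b a) => //.
- by right; exists u.
- by rewrite mulgK.
- by rewrite ltr0_norm// in Nab; rewrite -opprB.
Qed.

(** * Projections of word paths *)

Context (S : set G) (finS : finite_set S).
(* The path stays outside the subset H V of the group, where H is generated by h. *)
Local Notation path_avoids V p n := (forall i, (i <= n)%N ->
  forall a : int, ~ V (zexpg h (- a) * p i)%g).
Local Notation word_path p n :=
  (forall i, (i < n)%N -> S ((p i)^-1 * p i.+1)%g).

Lemma generator_step_le : exists2 J : R, 0 < J &
  forall g k, S (g^-1 * k)%g -> d (act g o) (act k o) <= J.
Proof.
have [J J0 HJ] := finite_set_bounded (fun s => d o (act s o)) finS.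
exists J => // g k Sgk; have := HJ _ Sgk.
by rewrite actM -act_dist_swap.
Qed.

(** Split the path at its first and last visits to the [D]-neighbourhood of the
    axis. Before the first and after the last visit the projection moves slowly,
    by [far_path_proj_le]. Between them it moves by a constant, since otherwise
    [wpd_finite_pairs] puts one of the two visits in [H V]. It is essential that
    [C] does not depend on [T]: only the set [V] to be avoided does. *)
Lemma short_word_path_proj_le (eta : R) : 0 < eta -> exists2 C : R, 0 <= C &
  forall T : nat, exists2 V : set G, finite_set V &
  forall (p : nat -> G) (n : nat), (n <= T)%N -> word_path p n ->
    path_avoids V p n ->
    d (pr (act (p 0%N) o)) (pr (act (p n) o)) <= eta * n%:R + C.
Proof.
move=> eta0; have [J J0 HJ] := generator_step_le.
have eta20 : 0 < eta / 2 by lra.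
have [D [B [D0 B0 far]]] := pr_far J0 eta20.
have [|N HN] := wpd_finite_pairs (D := D + 1); first by lra.
have [L [C [L0 C0 LC]]] := axis_quasigeodesic.
have LN0 : 0 <= L * N%:R by rewrite mulr_ge0// ltW.
exists (2 * B + (L * N%:R + C)); first by lra.
move=> T; pose U := \bigcup_(k in `I_T.+1) word_sphere S k.
have [|V finV HV] := HN U.
  by apply: bigcup_finite; [exact: finite_II|move=> k _; exact: finite_word_sphere].
exists V => // p n nT pS pV.
pose q i := act (p i) o.
have qJ i : (i < n)%N -> d (q i) (q i.+1) <= J by move=> /pS/HJ.
have farpart i k : (i + k <= n)%N ->
    (forall j, (0 < j < k)%N -> D <= rho (q (i + j)%N)) ->
    d (pr (q i)) (pr (q (i + k)%N)) <= eta / 2 * n%:R + B.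
  move=> ikn fark.
  have := far (fun j => q (i + j)%N) k _ fark; rewrite addn0 => H.
  apply: (le_trans (H _)); first by move=> j jk; rewrite addnS; apply: qJ; nat_lia.
  rewrite lerD2r ler_wpM2l ?(ltW eta20)// ler_nat; nat_lia.
have n0 : 0 <= eta / 2 * n%:R by rewrite mulr_ge0// ltW.
have [[i0 i0n near0]|allfar] :=
    pselect (exists2 i, (i <= n)%N & rho (q i) < D); last first.
  apply: (le_trans (farpart 0%N n _ _)) => //; last by lra.
  move=> j /andP[_ jn]; rewrite leNgt; apply/negP => jD; apply: allfar.
  by exists j => //; exact: ltnW.
have [i [/andP[_ ii0] neari ifirst]] :=
  @first_after (fun i => rho (q i) < D) 0 i0 isT near0.
have [j [/andP[i0j jn] nearj jlast]] :=
  @last_before (fun i => rho (q i) < D) i0 n i0n near0.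
have start : d (pr (q 0%N)) (pr (q i)) <= eta / 2 * n%:R + B.
  apply: (farpart 0%N i); first by nat_lia.
  move=> k /andP[_ ki]; rewrite leNgt; apply/negP; exact: ifirst.
have finish : d (pr (q j)) (pr (q n)) <= eta / 2 * n%:R + B.
  have nE : n = (j + (n - j))%N by nat_lia.
  move: (farpart j (n - j)%N); rewrite -nE; apply=> //.
  move=> k kn; rewrite leNgt; apply/negP; apply: jlast; nat_lia.
have middle : d (pr (q i)) (pr (q j)) <= L * N%:R + C.
  have [[_ [a _ <-] aE] ai] := pr_near (q i).
  have [[_ [b _ <-] bE] bj] := pr_near (q j).
  rewrite -aE -bE in ai bj *.
  have /andP[_ /le_trans] := LC a b; apply; rewrite lerD2r ler_wpM2l ?(ltW L0)//.
  rewrite -intrB -intr_norm -[leRHS]/(N%:Z%:~R) ler_int distrC.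
  rewrite leNgt; apply/negP => /ltW Nab.
  have pj : p j = (p i * ((p i)^-1 * p j))%g by rewrite mulVKg.
  have Uij : U ((p i)^-1 * p j)%g.
    exists (j - i)%N => /=; first by nat_lia.
    have -> : j = (i + (j - i))%N by nat_lia.
    rewrite addKn; apply: word_sphere_path => k ik; apply: pS; nat_lia.
  have [|||] := HV (p i) _ a b Uij _ _ Nab.
  - by rewrite (le_trans ai)// lerD2r ltW.
  - by rewrite -pj (le_trans bj)// lerD2r ltW.
  - by apply: pV; nat_lia.
  - by rewrite -pj; apply: pV; nat_lia.
have := metric_triangle (pr (q 0%N)) (pr (q i)) (pr (q n)).
have := metric_triangle (pr (q i)) (pr (q j)) (pr (q n)).
rewrite /q; lra.
Qed.

(** Cut the path into blocks whose length [T] is so large that the constant of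
    [short_word_path_proj_le] is at most [e / 2 * T]. *)
Lemma word_path_proj_le (e : R) : 0 < e -> exists2 C : R, 0 <= C &
  exists2 V : set G, finite_set V &
  forall (p : nat -> G) (n : nat), word_path p n -> path_avoids V p n ->
    d (pr (act (p 0%N) o)) (pr (act (p n) o)) <= e * n%:R + C.
Proof.
move=> e0; have e20 : 0 < e / 2 by lra.
have [C C0 HC] := short_word_path_proj_le e20.
pose T := (Num.bound (C / (e / 2))).+1.
have CT : C <= e / 2 * T%:R.
  rewrite mulrC -ler_pdivrMr// ltW// (lt_le_trans (archi_boundP _))//.
    by rewrite divr_ge0// ltW.
  by rewrite ler_nat.
have [V finV HV] := HC T.
exists (e / 2 * T%:R + C); first by rewrite addr_ge0// mulr_ge0// ltW.
exists V => // p n pS pV.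
have window i k : (k <= T)%N -> (i + k <= n)%N ->
    d (pr (act (p i) o)) (pr (act (p (i + k)%N) o)) <= e / 2 * k%:R + C.
  move=> kT ikn; have := HV (fun j => p (i + j)%N) k kT; rewrite addn0; apply.
    by move=> j jk; rewrite addnS; apply: pS; nat_lia.
  by move=> j jk; apply: pV; nat_lia.
apply: (@chain_dist_le _ _ (fun i => pr (act (p i) o)) T n) => //; first exact: ltW.
  by move=> i iT; apply: (le_trans (window i T _ iT)) => //; lra.
move=> i k kT ikn; apply: (le_trans (window i k kT ikn)).
by rewrite lerD2r ler_wpM2l ?(ltW e20)// ler_nat.
Qed.

(** * Sublinear bounds in the word metric *)

Context (symS : symmetric_set S) (genS : generating_set S).
Local Notation dS := (word_dist R S).
Local Notation H := (cyclic_subgroup h).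

(** Follow a geodesic word from [x] to [y]. Every element of [H V] lies within a
    bounded distance [K] of [H], whereas the [i]-th point of the path is at least
    [dS x y - i] away from [H]; so all but the last [M] points avoid [H V], and
    the last [M] steps move the projection by a bounded amount. *)
Lemma proj_sublinear (e : R) : 0 < e -> exists B : R,
  forall x y : G, dS x y <= dist_to dS H x ->
    d (pr (act x o)) (pr (act y o)) <= e * dS x y + B.
Proof.
move=> e0; have [C C0 [V finV HV]] := word_path_proj_le e0.
have [J J0 HJ] := generator_step_le.
have [K K0 HK] := finite_set_bounded (word_length R S) finV.
pose M := Num.bound K.
have KM : K < M%:R by apply: archi_boundP; exact: ltW.
have [|B B0 HB] := @proj_coarsely_lipschitz _ _ A _ kappaS _ pr_near pr_contr (J * M%:R).
  by rewrite mulr_ge0// ltW.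
exists (C + B) => x y xy.
have [w xyw dw] := word_length_attained R genS (x^-1 * y)%g.
rewrite -/(dS x y) in dw; rewrite dw in xy *.
have [p [p0 pn pS]] := words_path xyw.
rewrite -p0 in xy *; rewrite -pn.
set n := size w in xy pS *.
have stepM i : (n - M <= i <= n)%N -> d (act (p i) o) (act (p n) o) <= J * M%:R.
  move=> iM; have {1}-> : n = (i + (n - i))%N by nat_lia.
  apply: (le_trans (path_dist_le (q := fun j => act (p j) o) (J := J) _)).
    by move=> j jn; apply/HJ/pS; nat_lia.
  by rewrite ler_wpM2l ?(ltW J0)// ler_nat; nat_lia.
have en0 : 0 <= e * n%:R by rewrite mulr_ge0// ltW.
have [nM|Mn] := leqP n M.
  apply: (le_trans (HB _ _ (stepM 0%N _))); first by nat_lia.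
  by lra.
have close : d (pr (act (p (n - M)%N) o)) (pr (act (p n) o)) <= B.
  by apply/HB/stepM; nat_lia.
have : d (pr (act (p 0%N) o)) (pr (act (p (n - M)%N) o)) <= e * (n - M)%:R + C.
  apply: HV; first by move=> i iM; apply: pS; nat_lia.
  move=> i iM a /HK iK.
  have ia : dS (p i) (zexpg h a) <= K.
    by rewrite word_dist_sym// /word_dist -zexpgN.
  have p0i : dS (p 0%N) (p i) <= i%:R.
    by apply: word_path_dist_le => // k ki; apply: pS; nat_lia.
  have := word_dist_triangle R genS (p 0%N) (p i) (zexpg h a).
  have Ha : H (zexpg h a) by exists a.
  have := word_dist_to_le R genS (p 0%N) Ha.
  have : i%:R + M%:R <= n%:R :> R by rewrite -natrD ler_nat; nat_lia.
  by lra.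
have := metric_triangle (pr (act (p 0%N) o)) (pr (act (p (n - M)%N) o))
  (pr (act (p n) o)).
have : e * (n - M)%:R <= e * n%:R by rewrite ler_wpM2l ?(ltW e0)// ler_nat leq_subr.
by lra.
Qed.

(** The projection to [H], along the action, of the ball of radius [t] about [x],
    restricted to the points that are no farther from [x] than [H] is. The points
    of both projections in the theorem belong to such sets, so that one bound on
    their diameters gives both conclusions. *)
Definition ball_shadow (x : G) (t : R) : set G :=
  [set k | H k /\ exists y, [/\ dS x y <= dist_to dS H x, dS x y <= t
    & shortest_proj d A (act y o) (act k o)]].

(** By [proj_sublinear] the points of the shadow lie, in [X], within a small
    multiple of [t] plus a constant of the projection of [x]; along the axis,
    distances in [H] are at most linear in distances in [X]. *)
Lemma ball_shadow_dist_le (e : R) : 0 < e -> exists B : R,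
  forall (x : G) (t : R) (u v : G), ball_shadow x t u -> ball_shadow x t v ->
    dS u v <= e * t + B.
Proof.
move=> e0; have [L [C [L0 C0 LC]]] := axis_quasigeodesic.
have [c c0 Hc] := word_length_zexpg_le R genS h.
pose e' := e / (2 * L * (c + 1)).
have Lc0 : 0 < 2 * L * (c + 1) by rewrite !mulr_gt0// ltr_wpDl.
have [B HB] := proj_sublinear (divr_gt0 e0 Lc0).
have one k y : shortest_proj d A (act y o) (act k o) ->
    d (act k o) (pr (act y o)) <= kappa 0.
  move=> yk; rewrite -[in leRHS](mdistxx (act y o)).
  apply: axis_contracting => //; rewrite mdistxx dist_to_ge0//.
  by exists (pt 0); exact: axis_pt.
have near x t k : ball_shadow x t k ->
    d (act k o) (pr (act x o)) <= e' * t + B + kappa 0.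
  move=> [_ [y [xy yt yk]]].
  have := metric_triangle (act k o) (pr (act y o)) (pr (act x o)).
  have := one k y yk; have := HB x y xy.
  have : e' * dS x y <= e' * t by rewrite ler_wpM2l// ltW// divr_gt0.
  rewrite -/e' (metric_sym (pr (act x o))); lra.
exists ((c + 1) * (L * (2 * (B + kappa 0) + C))) => x t u v xu xv.
have [[a _ ua] [b _ vb]] := (proj1 xu, proj1 xv).
have ub : dS u v <= (c + 1) * `|b%:~R - a%:~R|.
  rewrite -ua -vb /word_dist -zexpgN -zexpgD addrC -intrB.
  by apply: (le_trans (Hc _)); rewrite ler_wpM2r// lerDl.
apply: (le_trans ub).
have -> : e * t + (c + 1) * (L * (2 * (B + kappa 0) + C)) =
    (c + 1) * (L * (2 * (e' * t) + 2 * (B + kappa 0) + C)).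
  have -> : e = 2 * L * (c + 1) * e' by rewrite mulrC divfK// gt_eqF.
  by lra.
rewrite ler_wpM2l ?addr_ge0// -ler_pdivrMl// distrC.
have /andP[+ _] := LC a b; rewrite ua vb.
have := metric_triangle (act u o) (pr (act x o)) (act v o).
have := near x t u xu; have := near x t v xv.
rewrite (metric_sym (act v o)); lra.
Qed.

Lemma ball_shadow_sublinear : exists2 kappa' : R -> R, sublinear kappa' &
  forall (x : G) (t : R), 0 <= t -> (diam dS (ball_shadow x t) <= (kappa' t)%:E)%E.
Proof.
have [|kappa' kS' Hk] := @sublinear_envelope R
  [set p | exists x u v, [/\ 0 <= p.1, ball_shadow x p.1 u, ball_shadow x p.1 v
    & p.2 = dS u v]].
  move=> e e0; have [B HB] := ball_shadow_dist_le e0; exists B.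
  by move=> [t w] /= [x [u [v [t0 xu xv ->]]]]; split=> //; exact: HB xu xv.
exists kappa' => // x t t0; apply: ge_ereal_sup => _ [u xu [v xv <-]].
by rewrite lee_fin; apply: (Hk (t, dS u v)); exists x, u, v.
Qed.

Lemma pullback_proj_ball_shadow (x y : G) (t : R) :
  dS x y <= dist_to dS H x -> dS x y <= t ->
  pullback_proj act o H y `<=` ball_shadow x t.
Proof.
move=> xy yt k [Hk yk]; split=> //; exists y; split=> //; split; first by exists k.
by rewrite yk lerDl.
Qed.

(** An element [k] of [H] nearest to [x] is its own projection, and it is as far
    from [x] as [H] is. *)
Lemma word_proj_ball_shadow (x : G) : word_proj R S H x `<=`
  ball_shadow x (dist_to dS H x).
Proof.
move=> k [Hk xk]; split=> //; exists k; rewrite xk; split=> //.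
have Ak : A (act k o) by exists k.
by split=> //; rewrite mdistxx addr_ge0// dist_to_ge0//; exists (act k o).
Qed.

End Axis.

Theorem mainTheorem1 (R : realType) (G : groupType) (S : set G)
    (finS : finite_set S) (symS : symmetric_set S) (genS : generating_set S)
    (X : metricType R) (geoX : geodesic_space X)
    (act : G -> X -> X) (actX : isometric_action act) (o : X)
    (h : G) (wpd_h : WPD act h)
    (kappa : R -> R) (kappaS : sublinear kappa)
    (contr_h : strongly_contracting_orbit kappa act h o) :
  let H := cyclic_subgroup h in
  sublinear_projection_tracking S act o H /\
  strongly_sublinearly_contracting (word_dist R S) H (pullback_proj act o H).
Proof.
set d := @mdist R X; set A := [set act g o | g in cyclic_subgroup h].
have proj_ne x : shortest_proj d A x !=set0.
  by apply: shortest_proj_nonempty; exists (act 1%g o), 1%g => //; exists 0.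
have [pr pr_near] := choice proj_ne.
have [kappa' kS' Hk] :=
  ball_shadow_sublinear actX kappaS contr_h pr_near wpd_h finS symS genS.
have H1 : cyclic_subgroup h 1%g by exists 0.
have t0 x : 0 <= dist_to (word_dist R S) (cyclic_subgroup h) x.
  by apply: word_dist_to_ge0 => //; exists 1%g.
have xx x : word_dist R S x x <= dist_to (word_dist R S) (cyclic_subgroup h) x.
  by rewrite word_distxx.
split; exists kappa' => //.
  move=> x; apply: le_trans (Hk x _ (t0 x)); apply: diam_le => k [|].
    exact: word_proj_ball_shadow.
  exact: pullback_proj_ball_shadow.
have d0 x y : 0 <= word_dist R S x y by exact: word_length_ge0.
move=> x y xy; apply: le_trans (Hk x _ (d0 x y)); apply: diam_le => k [|].
  by apply: pullback_proj_ball_shadow => //; rewrite word_distxx.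
exact: pullback_proj_ball_shadow.
Qed.
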